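(* Let $n\ge2$. Each polynomial $p\in\Delta_n$ gives rise to a $(4n+4)$-dimensional hypercomplex almost abelian solvmanifold $\Gamma_p\backslash G_p$ with $G_p$ completely solvable; that is, the simply connected almost abelian Lie group $G_p$ is completely solvable and admits a left invariant hypercomplex structure, and $\Gamma_p$ is a lattice in $G_p$.
   Context: For $n\ge2$, $\Delta_n$ is the set of monic polynomials $p\in\mathbb{Z}[x]$ of degree $n$ having $n$ different real roots, all of them positive, and with $p(0)=(-1)^n$. For $p\in\Delta_n$ with roots $r_1<\dots<r_n$ let $X_p=\operatorname{diag}(\log r_1,\dots,\log r_n)$ and $A_p=0_3\oplus X_p^{\oplus4}\in\mathfrak{gl}(4n+3,\mathbb{R})$ (block diagonal, $0_3$ the $3\times 3$ zero matrix, four copies of $X_p$). $G_p=\mathbb{R}\ltimes_\varphi\mathbb{R}^{4n+3}$ is the simply connected Lie group with $\varphi(t)=e^{tA_p}$ and product $(t,v)(s,w)=(t+s,v+\varphi(t)w)$; its Lie algebra is $\mathbb{R}e_0\ltimes_{A_p}\mathbb{R}^{4n+3}$, with $\mathbb{R}^{4n+3}$ an abelian ideal and $[e_0,v]=A_pv$. Let $C_p$ be the companion matrix of $p$ and $\widetilde C_p=I_3\oplus C_p^{\oplus4}$. $\Gamma_p=\mathbb{Z}\ltimes_{\varphi(1)}Q_p\mathbb{Z}^{4n+3}\subset G_p$, where $Q_p\in\operatorname{GL}(4n+3,\mathbb{R})$ satisfies $Q_p^{-1}\varphi(1)Q_p=\widetilde C_p$ (such $Q_p$ exists). A Lie group is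 almost abelian if its Lie algebra has a codimension one abelian ideal; a solvable Lie group with Lie algebra $\mathfrak g$ is completely solvable if $\operatorname{ad}_x$ has only real eigenvalues for all $x\in\mathfrak{g}$. A lattice is a discrete subgroup with compact quotient; a solvmanifold is a compact quotient $\Gamma\backslash G$ of a simply connected solvable Lie group by a lattice. A hypercomplex structure is a triple of (integrable) complex structures $J_1,J_2,J_3$ with $J_1J_2=-J_2J_1=J_3$; a left invariant one on $G$ induces one on $\Gamma\backslash G$. *)

(* Defs.v *)
From HB Require Import structures.
From mathcomp Require Import all_boot all_order all_algebra.
From mathcomp Require Import all_classical all_reals all_analysis.
From mathcomp.real_closed Require Import complex.

Set Implicit Arguments.
Unset Strict Implicit.
Unset Printing Implicit Defensive.

Import Order.TTheory GRing.Theory Num.Theory.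
Import numFieldNormedType.Exports.

Local Open Scope classical_set_scope.
Local Open Scope ring_scope.

Section Topology.
Variables (R : realType) (T : topologicalType).

Definition path_connected : Prop :=
  forall x y : T, exists f : R -> T,
    [/\ {within `[0, 1], continuous f}, f 0 = x & f 1 = y].

Definition null_homotopic (f : R -> T) : Prop :=
  exists H : R * R -> T,
    [/\ {within [set st : R * R | 0 <= st.1 <= 1 /\ 0 <= st.2 <= 1],
           continuous H},
        (forall s, 0 <= s <= 1 -> H (s, 0) = f s /\ H (s, 1) = f 0)
      & (forall t, 0 <= t <= 1 -> H (0, t) = f 0 /\ H (1, t) = f 0)].

Definition simply_connected : Prop :=
  path_connected /\
  forall f : R -> T, {within `[0, 1], continuous f} -> f 0 = f 1 ->
    null_homotopic f.

End Topology.

Section Smooth.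
Variable R : realType.

(* In finite dimension, [Ck k f] for all [k] is C^oo smoothness. *)
Fixpoint Ck (V W : normedModType R) (k : nat) (f : V -> W) : Prop :=
  if k is k'.+1 then
    (forall x, differentiable f x) /\ (forall v : V, Ck k' ('D_v f))
  else continuous f.

Definition smooth (V W : normedModType R) (f : V -> W) : Prop :=
  forall k, Ck k f.

End Smooth.

(* Lie groups covered by a single global chart, with underlying manifold
   R^N; all tangent spaces are identified with R^N by the chart. *)
Section LieGroups.
Variables (R : realType) (N : nat).
Local Notation V := ('cV[R]_N).

Record group_law := GroupLaw { gmul : V -> V -> V; gone : V; ginv : V -> V }.

Variable G : group_law.

Definition is_group : Prop :=
  [/\ (forall x y z, gmul G x (gmul G y z) = gmul G (gmul G x y) z),
      (forall x, gmul G (gone G) x = x /\ gmul G x (gone G) = x)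
    & (forall x, gmul G (ginv G x) x = gone G /\
                 gmul G x (ginv G x) = gone G)].

Definition is_lie_group : Prop :=
  [/\ is_group, smooth (fun xy : V * V => gmul G xy.1 xy.2)
    & smooth (ginv G)].

Definition vf_bracket (X Y : V -> V) (g : V) : V :=
  'D_(X g) Y g - 'D_(Y g) X g.

(* The differential at [h] of the left translation by [g]. *)
Definition dL (g h v : V) : V := 'D_v (gmul G g) h.

Definition left_invariant_vf (x : V) (g : V) : V := dL g (gone G) x.

(* The Lie algebra of [G] is the tangent space at the identity, i.e. [V],
   with the bracket of the left invariant vector fields. *)
Definition lie_bracket (x y : V) : V :=
  vf_bracket (left_invariant_vf x) (left_invariant_vf y) (gone G).

Definition almost_abelian : Prop :=
  exists U : {vspace V},
    [/\ (\dim U).+1 = \dim {:V},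
        (forall x u, u \in U -> lie_bracket x u \in U)
      & (forall u v, u \in U -> v \in U -> lie_bracket u v = 0)].

(* By bilinearity, the brackets of basis elements span [U, U]. *)
Definition derived (U : {vspace V}) : {vspace V} :=
  <<[seq lie_bracket u v | u <- vbasis U, v <- vbasis U]>>%VS.

Definition lie_solvable : Prop := exists k, iter k derived fullv = 0%VS.

Definition ad_mx (x : V) : 'M[R]_N :=
  \matrix_(i, j) lie_bracket x (delta_mx j 0) i 0.

Definition completely_solvable : Prop :=
  lie_solvable /\
  forall (x : V) (z : R[i]),
    eigenvalue (map_mx (real_complex R) (ad_mx x)) z -> complex.Im z = 0.

Definition mul_vf (J : V -> 'M[R]_N) (X : V -> V) (g : V) : V := J g *m X g.

Definition integrable (J : V -> 'M[R]_N) : Prop :=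
  forall X Y : V -> V, smooth X -> smooth Y -> forall g,
    vf_bracket X Y g
    + J g *m (vf_bracket (mul_vf J X) Y g + vf_bracket X (mul_vf J Y) g)
    - vf_bracket (mul_vf J X) (mul_vf J Y) g = 0.

Definition complex_structure (J : V -> 'M[R]_N) : Prop :=
  [/\ smooth J, (forall g, J g *m J g = - 1%:M) & integrable J].

Definition left_invariant (J : V -> 'M[R]_N) : Prop :=
  forall g h v : V, J (gmul G g h) *m dL g h v = dL g h (J h *m v).

Definition left_invariant_hypercomplex (J1 J2 J3 : V -> 'M[R]_N) : Prop :=
  [/\ complex_structure J1 /\ left_invariant J1,
      complex_structure J2 /\ left_invariant J2,
      complex_structure J3 /\ left_invariant J3
    & forall g, J1 g *m J2 g = J3 g /\ - (J2 g *m J1 g) = J3 g].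

(* The quotient Gamma \ G, as the quotient of [V] by the relation
   "Gamma g = Gamma h", with the quotient topology. *)
Section Quotient.
Variable Gamma : set V.

Definition right_coset (g : V) : set V := [set gmul G x g | x in Gamma].

Definition same_coset (g h : V) : bool := `[< right_coset g = right_coset h >].

Lemma same_coset_refl : reflexive same_coset.
Proof. by move=> g; apply/asboolP. Qed.

Lemma same_coset_sym : symmetric same_coset.
Proof. by move=> g h; apply/asboolP/asboolP. Qed.

Lemma same_coset_trans : transitive same_coset.
Proof. by move=> h g k /asboolP gh /asboolP hk; apply/asboolP; rewrite gh. Qed.

Definition same_coset_equiv : equiv_rel V :=
  EquivRel same_coset same_coset_refl same_coset_sym same_coset_trans.

Definition quotient_space : topologicalType :=
  quotient_topology {eq_quot same_coset_equiv}%qT.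

Definition is_subgroup : Prop :=
  [/\ Gamma (gone G),
      (forall x y, Gamma x -> Gamma y -> Gamma (gmul G x y))
    & (forall x, Gamma x -> Gamma (ginv G x))].

Definition discrete_in : Prop := forall x, Gamma x -> isolated Gamma x.

Definition lattice : Prop :=
  [/\ is_subgroup, discrete_in & compact [set: quotient_space]].

End Quotient.

End LieGroups.

Section Gp.
Variable R : realType.

Definition real_poly (p : {poly int}) : {poly R} := map_poly intr p.

Definition Delta (n : nat) (p : {poly int}) : Prop :=
  [/\ p \is monic, size p = n.+1, p.[0] = (-1) ^+ n
    & exists s : seq R,
        [/\ size s = n, uniq s, all (root (real_poly p)) s
          & all (fun x => 0 < x) s]].

(* [r] lists roots of [p] in increasing order; all of them if p has degree n. *)
Definition ordered_roots (n : nat) (p : {poly int}) (r : 'rV[R]_n) : Prop :=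
  (forall i, root (real_poly p) (r 0 i)) /\
  (forall i j : 'I_n, (i < j)%N -> r 0 i < r 0 j).

Definition expmx (m : nat) (A : 'M[R]_m) : 'M[R]_m :=
  limn (series (fun k => (k`!%:R)^-1 *: A ^+ k)).

(* 4 n + 3, associated so as to match the block decomposition below. *)
Definition fdim (n : nat) : nat := (3 + (n + (n + (n + n))))%N.

Definition dsum4 (n : nat) (B : 'M[R]_3) (X : 'M[R]_n) : 'M[R]_(fdim n) :=
  block_mx B 0 0 (block_mx X 0 0 (block_mx X 0 0 (block_mx X 0 0 X))).

Definition Xmx (n : nat) (r : 'rV[R]_n) : 'M[R]_n := diag_mx (map_mx (@ln R) r).

Definition Amx (n : nat) (r : 'rV[R]_n) : 'M[R]_(fdim n) := dsum4 0 (Xmx r).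

Definition phi (n : nat) (r : 'rV[R]_n) (t : R) : 'M[R]_(fdim n) :=
  expmx (t *: Amx r).

(* [companionmx] lives in dimension [(size p).-1], which is n on [Delta n];
   [conform_mx] is then a cast. *)
Definition Cmx (n : nat) (p : {poly int}) : 'M[R]_n :=
  conform_mx 0 (companionmx (real_poly p)).

Definition Ctilde (n : nat) (p : {poly int}) : 'M[R]_(fdim n) :=
  dsum4 1%:M (Cmx n p).

(* The pair (t, v) in R x R^(4n+3) and its two projections. *)
Definition pairmx (n : nat) (t : R) (v : 'cV[R]_(fdim n))
    : 'cV[R]_(1 + fdim n) :=
  col_mx t%:M v.

Definition time (n : nat) (g : 'cV[R]_(1 + fdim n)) : R := usubmx g 0 0.

Definition space (n : nat) (g : 'cV[R]_(1 + fdim n)) : 'cV[R]_(fdim n) :=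
  dsubmx g.

Definition Gp (n : nat) (r : 'rV[R]_n) : group_law R (1 + fdim n) :=
  {| gmul := fun g h =>
       pairmx (time g + time h) (space g + phi r (time g) *m space h);
     gone := pairmx 0 0;
     ginv := fun g =>
       pairmx (- time g) (- (phi r (- time g) *m space g)) |}.

Definition conjugates (n : nat) (p : {poly int}) (r : 'rV[R]_n)
    (Q : 'M[R]_(fdim n)) : Prop :=
  Q \in unitmx /\ invmx Q *m phi r 1 *m Q = Ctilde n p.

Definition Gamma_p (n : nat) (Q : 'M[R]_(fdim n)) : set 'cV[R]_(1 + fdim n) :=
  [set g | exists (k : int) (z : 'cV[int]_(fdim n)),
     g = pairmx k%:~R (Q *m map_mx intr z)].

End Gp.

(* Main.v *)
(** The matrix phi(t) is diagonal, with entries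
  e^(t a), where the weights a are 0 (three times) and each log r_i (four
  times); so left translations are affine with diagonal linear part, and the
  bracket is [x, y] = (0, t_x A y - t_y A x), whence everything about the Lie
  algebra.  Together with the time coordinate every weight has multiplicity
  4, so that R^(4n+4) = H^(n+1) with phi acting on each copy of H by a real
  scalar: left multiplication by the unit quaternions commutes with all left
  translations, and is thus a left invariant structure which is constant in
  the chart, hence integrable.  Finally the companion matrix of p is
  diagonalized by the Vandermonde matrix of the roots and has determinant 1,
  so phi(k) preserves the lattice Q Z^(4n+3) for all integers k; Gamma_p is
  the set of integral points in the coordinates (t, Q^-1 v), and the unit
  cube of these coordinates meets all cosets. *)

Require Import Defs.
From HB Require Import structures.
From mathcomp Require Import all_boot all_order all_algebra.
From mathcomp Require Import all_classical all_reals all_analysis.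
From mathcomp Require Import ring lra zify.
From mathcomp.real_closed Require Import complex.
Import Order.TTheory GRing.Theory Num.Theory.
Import numFieldNormedType.Exports.
Local Open Scope classical_set_scope.
Local Open Scope ring_scope.
Set Implicit Arguments.
Unset Strict Implicit.
Unset Printing Implicit Defensive.

(* Unqualified, [space] is now a constructor of [{vspace _}]. *)
Local Notation space := Defs.space.

(** * Smoothness criteria and the exponential of a diagonal matrix *)

Section Smooth.
Variable R : realType.

(* These functions are smooth because they are closed under directional
   derivatives, see [exp_poly_derive]. *)
Inductive exp_poly (V : normedModType R) : (V -> R) -> Prop :=
| exp_poly_cst c : exp_poly (fun=> c)
| exp_poly_lin (f : V -> R) : linear f -> continuous f -> exp_poly f
| exp_poly_add f g : exp_poly f -> exp_poly g ->
    exp_poly (fun x => f x + g x)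
| exp_poly_mul f g : exp_poly f -> exp_poly g ->
    exp_poly (fun x => f x * g x)
| exp_poly_exp f : exp_poly f -> exp_poly (fun x => expR (f x)).

Lemma exp_poly_sum (V : normedModType R) (I : Type) (l : seq I) (F : I -> V -> R) :
  (forall i, exp_poly (F i)) -> exp_poly (fun x => \sum_(i <- l) F i x).
Proof.
move=> hF; rewrite -fct_sumE.
apply: (big_ind (@exp_poly V)) => [|f g|i _]; last exact: hF.
- exact: exp_poly_cst.
- exact: exp_poly_add.
Qed.

Lemma is_diff_linear (V : normedModType R) (f : V -> R) x :
  linear f -> continuous f -> is_diff x f f.
Proof.
move=> flin fcont; pose fM := GRing.isLinear.Build _ _ _ _ _ flin.
pose fL : {linear V -> R} := HB.pack f fM.
rewrite -[f]/(fL : V -> R); apply: DiffDef; first exact: linear_differentiable.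
exact: diff_lin.
Qed.

Lemma differentiable_exp_poly (V : normedModType R) (f : V -> R) x :
  exp_poly f -> differentiable f x.
Proof.
move=> hf; elim: hf x => {f} [c|f lf cf|f g _ IHf _ IHg|f g _ IHf _ IHg|f _ IH] x.
- exact: differentiable_cst.
- by have [] := is_diff_linear x lf cf.
- exact: differentiableD.
- exact: differentiableM.
- apply: differentiable_comp => //; apply/derivable1_diffP.
  exact: derivable_expR.
Qed.

Lemma derive_expR_comp (V : normedModType R) (f : V -> R) (x v : V) :
  differentiable f x ->
  'D_v (fun y => expR (f y)) x = expR (f x) * 'D_v f x.
Proof.
move=> df; have de : differentiable (@expR R) (f x).
  exact/derivable1_diffP/derivable_expR.
rewrite deriveE ?[in LHS](diff_comp df de); last exact: differentiable_comp.
by rewrite /= deriv1E ?derivable_expR// derive1E derive_val [in RHS]deriveE// mulrC.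
Qed.

(** The difference quotient at [a] along [v] is constantly [w] away from 0. *)
Lemma is_derive_affine (V W : normedModType R) (f : V -> W) (a v : V) (w : W) :
  (forall h, f (h *: v + a) = f a + h *: w) -> is_derive a v f w.
Proof.
move=> fE.
have fc : (fun h => h^-1 *: (f (h *: v + a) - f a)) @ 0^' --> w.
  apply: cvg_near_cst; near=> h; rewrite fE addrC addKr scalerA mulVf.
    by rewrite scale1r.
  by near: h; exact: nbhs_dnbhs_neq.
by split; [apply/cvg_ex; exists w|exact: cvg_lim].
Unshelve. all: by end_near. Qed.

Lemma exp_poly_derive (V : normedModType R) (f : V -> R) (v : V) :
  exp_poly f -> exp_poly ('D_v f).
Proof.
elim=> {f} [c|f lf cf|f g hf IHf hg IHg|f g hf IHf hg IHg|f hf IH].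
- suff -> : 'D_v (fun=> c) = (fun=> 0 : R) :> (V -> R) by exact: exp_poly_cst.
  by apply/funext => x; rewrite derive_cst.
- suff -> : 'D_v f = (fun=> f v) by exact: exp_poly_cst.
  by apply/funext => x; have [df {2}<-] := is_diff_linear x lf cf; rewrite deriveE.
- suff -> : 'D_v (fun x => f x + g x) = (fun x => 'D_v f x + 'D_v g x).
    exact: exp_poly_add.
  by apply/funext => x; rewrite -deriveD//;
    exact/diff_derivable/differentiable_exp_poly.
- suff -> : 'D_v (fun x => f x * g x) = (fun x => f x * 'D_v g x + g x * 'D_v f x).
    by apply: exp_poly_add; exact: exp_poly_mul.
  by apply/funext => x; rewrite -[RHS]deriveM//;
    exact/diff_derivable/differentiable_exp_poly.
- suff -> : 'D_v (fun x => expR (f x)) = (fun x => expR (f x) * 'D_v f x).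
    by apply: exp_poly_mul => //; exact: exp_poly_exp.
  by apply/funext => x; apply/derive_expR_comp/differentiable_exp_poly.
Qed.

Lemma differentiable_mx (V : normedModType R) m n (F : V -> 'M[R]_(m, n)) x :
  (forall i j, differentiable (fun y => F y i j) x) -> differentiable F x.
Proof.
move=> dF.
have -> : F = \sum_i \sum_j (fun y => F y i j *: delta_mx i j).
  apply/funext => y; rewrite fct_sumE {1}[F y]matrix_sum_delta.
  by apply: eq_bigr => i _; rewrite fct_sumE.
apply: differentiable_sum => i; apply: differentiable_sum => j.
exact: differentiableZl.
Qed.

(** [Ck] recurses on directional derivatives. These are taken entrywise and [exp_poly] is stable
    under them, so the induction on [k] reproduces its hypothesis. *)
Lemma smooth_mx (V : normedModType R) m n (F : V -> 'M[R]_(m, n)) :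
  (forall i j, exp_poly (fun x => F x i j)) -> smooth F.
Proof.
move=> hF k; elim: k F hF => [|k IH] F hF /=.
  move=> x; apply/differentiable_continuous/differentiable_mx => i j.
  exact: differentiable_exp_poly.
have dF x : differentiable F x.
  by apply: differentiable_mx => i j; exact: differentiable_exp_poly.
split=> // v; apply: IH => i j.
have -> : (fun x => 'D_v F x i j) = 'D_v (fun x => F x i j).
  by apply/funext => x; rewrite derive_mx ?mxE//; exact/diff_derivable.
exact: exp_poly_derive.
Qed.

Lemma exp_poly_coord m n (i : 'I_m) (j : 'I_n) :
  exp_poly (fun M : 'M[R]_(m, n) => M i j).
Proof.
apply: exp_poly_lin => [a x y|]; first by rewrite !mxE.
exact: coord_continuous.
Qed.

Lemma continuous_mulmx m k l (A : 'M[R]_(m, k)) :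
  continuous (fun B : 'M[R]_(k, l) => A *m B).
Proof.
(* Continuity is [Ck] at order 0. *)
apply: (@smooth_mx _ _ _ _ _ 0%N) => i j.
rewrite (_ : (fun _ => _) = fun B : 'M[R]_(k, l) => \sum_h A i h * B h j); last first.
  by apply/funext => B; rewrite mxE.
apply: exp_poly_sum => h.
by apply: exp_poly_mul; [exact: exp_poly_cst|exact: exp_poly_coord].
Qed.

Lemma continuous_trmx m n : continuous (@trmx R m n).
Proof.
apply: (@smooth_mx _ _ _ _ _ 0%N) => i j.
rewrite (_ : (fun _ => _) = fun A : 'M[R]_(m, n) => A j i).
  exact: exp_poly_coord.
by apply/funext => A; rewrite mxE.
Qed.

Lemma mx_cvg m n (F : nat -> 'M[R]_(m, n)) (l : 'M[R]_(m, n)) :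
  (forall i j, F k i j @[k --> \oo] --> l i j) -> F @ \oo --> l.
Proof.
move=> Fl; apply/cvgrPdist_le => e e0; near=> k.
rewrite [leLHS]/Num.Def.normr/= mx_normrE bigmax_le ?ltW//= => i _.
rewrite !mxE/=; move: i; near: k; apply: filter_forall => i.
exact: ((cvgrPdist_le _ _).1 (Fl i.1 i.2)).
Unshelve. all: by end_near. Qed.

Lemma exp_diag_mx m (d : 'rV[R]_m) k :
  diag_mx d ^+ k = diag_mx (map_mx (fun x => x ^+ k) d).
Proof.
elim: k => [|k IH].
  rewrite expr0; apply/matrixP => i j; rewrite !mxE expr0 //.
rewrite exprS IH -[LHS]/(_ *m _) mulmx_diag; congr diag_mx.
by apply/rowP => i; rewrite !mxE exprS.
Qed.

(** The partial sums are diagonal matrices of partial sums of the scalar exponential series, and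
    matrices converge entrywise. *)
Lemma expmx_diag m (d : 'rV[R]_m) :
  expmx (diag_mx d) = diag_mx (map_mx (@expR R) d).
Proof.
apply: cvg_lim; first exact: norm_hausdorff.
apply: mx_cvg => i j; rewrite !mxE.
have -> : (fun k => series (fun k0 => (k0`!%:R)^-1 *: diag_mx d ^+ k0) k i j)
   = (fun k => series (exp_coeff (d 0 i)) k *+ (i == j)).
  apply/funext => k; rewrite /series/= summxE -sumrMnl; apply: eq_bigr => l _.
  by rewrite exp_diag_mx !mxE mulrnAr mulrC.
case: (i == j) => /=.
 - under eq_fun do rewrite mulr1n. rewrite mulr1n. exact: is_cvg_series_exp_coeff.
 - under eq_fun do rewrite mulr0n. rewrite mulr0n. exact: cvg_cst.
Qed.

End Smooth.

(** * The Lie group structure of [Gp] *)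

Section Group.
Variables (R : realType) (n : nat) (r : 'rV[R]_n).
Local Notation V := 'cV[R]_(1 + fdim n).

Definition weights : 'rV[R]_(fdim n) :=
  let x := map_mx (@ln R) r in row_mx 0 (row_mx x (row_mx x (row_mx x x))).

Lemma dsum4_diag (b : 'rV[R]_3) (x : 'rV[R]_n) :
  dsum4 (diag_mx b) (diag_mx x) =
  diag_mx (row_mx b (row_mx x (row_mx x (row_mx x x)))).
Proof. by rewrite !diag_mx_row. Qed.

Lemma Amx_diag : Amx r = diag_mx weights.
Proof. by rewrite -dsum4_diag /Amx raddf0. Qed.

Lemma phiE t : phi r t = diag_mx (map_mx (fun a => expR (t * a)) weights).
Proof.
rewrite /phi Amx_diag -linearZ expmx_diag; congr diag_mx.
by apply/rowP => i; rewrite !mxE.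
Qed.

Lemma phi0 : phi r 0 = 1%:M.
Proof.
rewrite phiE -diag_const_mx; congr diag_mx; apply/rowP => i.
by rewrite !mxE mul0r expR0.
Qed.

Lemma phiD s t : phi r (s + t) = phi r s *m phi r t.
Proof.
rewrite !phiE mulmx_diag; congr diag_mx; apply/rowP => i.
by rewrite !mxE mulrDl expRD.
Qed.

Lemma phiK t : phi r (- t) *m phi r t = 1%:M.
Proof. by rewrite -phiD addNr phi0. Qed.

Lemma phiVK t : phi r t *m phi r (- t) = 1%:M.
Proof. by rewrite -phiD addrN phi0. Qed.

Lemma phi_mulE t (v : 'cV[R]_(fdim n)) i :
  (phi r t *m v) i 0 = expR (t * weights 0 i) * v i 0.
Proof. by rewrite phiE mul_diag_mx !mxE. Qed.

Lemma Amx_mulE (v : 'cV[R]_(fdim n)) i :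
  (Amx r *m v) i 0 = weights 0 i * v i 0.
Proof. by rewrite Amx_diag mul_diag_mx mxE. Qed.

Lemma time_pairmx t (v : 'cV[R]_(fdim n)) : time (pairmx t v) = t.
Proof. by rewrite /time col_mxKu mxE. Qed.

Lemma space_pairmx t (v : 'cV[R]_(fdim n)) : space (pairmx t v) = v.
Proof. by rewrite /space col_mxKd. Qed.

Lemma pairmx_eta (g : V) : pairmx (time g) (space g) = g.
Proof. by rewrite /pairmx /time /space -mx11_scalar vsubmxK. Qed.

Lemma timeE (g : V) : time g = g (lshift _ 0) 0.
Proof. by rewrite /time mxE. Qed.

Lemma spaceE (g : V) i : space g i 0 = g (rshift 1 i) 0.
Proof. by rewrite /space mxE. Qed.

Lemma pairmx_time t v : @pairmx R n t v (lshift _ 0) 0 = t.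
Proof. by rewrite -timeE time_pairmx. Qed.

Lemma pairmx_space t v i : @pairmx R n t v (rshift 1 i) 0 = v i 0.
Proof. by rewrite -spaceE space_pairmx. Qed.

Lemma Gp_is_group : is_group (Gp r).
Proof.
split=> [x y z|x|x] /=; rewrite ?time_pairmx ?space_pairmx.
- by rewrite addrA mulmxDr mulmxA -phiD addrA.
- by rewrite phi0 mulmx0 mul1mx !(addr0, add0r) pairmx_eta.
- by rewrite mulmxN mulmxA phiVK mul1mx !addNr !addrN.
Qed.

(** Splits an entrywise claim about a column into the time coordinate and the space coordinates. *)
Lemma col_ind (P : 'I_(1 + fdim n) -> 'I_1 -> Prop) :
  P (lshift _ 0) 0 -> (forall i, P (rshift 1 i) 0) -> forall i j, P i j.
Proof.
by move=> P0 P1 i j; rewrite (ord1 j) -(fintype.splitK i);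
  case: (fintype.split i) => k //=; rewrite ?(ord1 k).
Qed.

Lemma Gp_is_lie_group : is_lie_group (Gp r).
Proof.
have cst := @exp_poly_cst R.
split; first exact: Gp_is_group.
- apply: smooth_mx => i j.
  have c1 k : exp_poly (fun xy : V * V => xy.1 k 0).
    apply: exp_poly_lin => [a x y|x]; first by rewrite !mxE.
    apply: (@continuous_comp _ _ _ fst (fun M : V => M k 0)).
      exact: cvg_fst.
    exact: coord_continuous.
  have c2 k : exp_poly (fun xy : V * V => xy.2 k 0).
    apply: exp_poly_lin => [a x y|x]; first by rewrite !mxE.
    apply: (@continuous_comp _ _ _ snd (fun M : V => M k 0)).
      exact: cvg_snd.
    exact: coord_continuous.
  move: i j; apply: col_ind => [|i] /=.
    under eq_fun do rewrite pairmx_time !timeE; exact: exp_poly_add.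
  under eq_fun do rewrite pairmx_space mxE phi_mulE timeE !spaceE.
  by apply: exp_poly_add => //; apply: exp_poly_mul => //; apply: exp_poly_exp;
    exact: exp_poly_mul.
- apply: smooth_mx => i j.
  have c k : exp_poly (fun x : V => x k 0).
    exact: exp_poly_coord.
  move: i j; apply: col_ind => [|i] /=.
    (* Opposites become products with -1, since [exp_poly] has a constructor for products but none
       for opposites. *)
    by under eq_fun do rewrite pairmx_time timeE -mulN1r; exact: exp_poly_mul.
  under eq_fun do rewrite pairmx_space mxE phi_mulE timeE !spaceE -mulN1r
    -[- _ as X in expR (X * _)]mulN1r.
  by do 2 apply: exp_poly_mul => //; apply: exp_poly_exp;
    do 2 apply: exp_poly_mul => //.
Qed.

End Group.

(** * Left invariant vector fields and their bracket *)

Section LieAlgebra.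
Variables (R : realType) (n : nat) (r : 'rV[R]_n).
Local Notation V := 'cV[R]_(1 + fdim n).

Lemma timeD (a : R) (x y : V) : time (a *: x + y) = a * time x + time y.
Proof. by rewrite !timeE !mxE. Qed.

Lemma spaceD (a : R) (x y : V) : space (a *: x + y) = a *: space x + space y.
Proof. by rewrite /space linearP. Qed.

Lemma pair_ext (x y : V) : time x = time y -> space x = space y -> x = y.
Proof. by move=> xt xs; rewrite -[LHS]pairmx_eta xt xs pairmx_eta. Qed.

(** Left translation by [g] is affine in the chart, so its differential is its linear part at every
    [h]. *)
Lemma dLE (g h v : V) :
  dL (Gp r) g h v = pairmx (time v) (phi r (time g) *m space v).
Proof.
suff dLg : is_derive h v (gmul (Gp r) g)
    (pairmx (time v) (phi r (time g) *m space v)) by exact: derive_val.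
apply: is_derive_affine => a /=.
rewrite [RHS]addrC; apply: pair_ext.
  by rewrite !(timeD, time_pairmx) addrCA.
by rewrite !(spaceD, space_pairmx) mulmxDr -scalemxAr addrCA.
Qed.

Lemma left_invariant_vfE (x g : V) :
  left_invariant_vf (Gp r) x g = pairmx (time x) (phi r (time g) *m space x).
Proof. exact: dLE. Qed.

(** Only the factors e^(t a) depend on the base point; differentiating them along [x] produces the
    time of [x] and the weight a, that is, a factor [Amx r]. *)
Lemma derive_left_invariant_vf (x y g : V) :
  'D_x (left_invariant_vf (Gp r) y) g =
  pairmx 0 (time x *: (phi r (time g) *m (Amx r *m space y))).
Proof.
have -> : left_invariant_vf (Gp r) y =
    fun g => pairmx (time y) (phi r (time g) *m space y).
  by apply/funext => h; rewrite left_invariant_vfE.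
have dt w : is_derive g x (fun h : V => time h * w) (time x * w).
  apply: is_derive_affine => a; rewrite timeD mulrDl addrC -mulrA //.
have dexp w : differentiable (fun h : V => time h * w) g.
  apply: differentiable_exp_poly; apply: exp_poly_mul (exp_poly_cst _ _).
  apply: exp_poly_lin => [a u v|]; first by rewrite timeD.
  by rewrite (funext (@timeE R n)); exact: coord_continuous.
have ed w : differentiable (fun h : V => expR (time h * w)) g.
  apply: (differentiable_comp (dexp w)); apply/derivable1_diffP.
  exact: derivable_expR.
have D i j : is_derive g x
   (fun h : V => pairmx (time y) (phi r (time h) *m space y) i j)
   (pairmx 0 (time x *: (phi r (time g) *m (Amx r *m space y))) i j).
  move: i j; apply: col_ind => [|i].
    rewrite pairmx_time (_ : (fun _ => _) = cst (time y)); first exact: is_derive_cst.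
    by apply/funext => h; rewrite pairmx_time.
  set w := weights r 0 i; set s := space y i 0.
  rewrite pairmx_space mxE phi_mulE Amx_mulE -/w -/s.
  rewrite (_ : (fun _ => _) = s *: (fun h : V => expR (time h * w))); last first.
    by apply/funext => h; rewrite pairmx_space phi_mulE mulrC.
  have /derivableP eD : derivable (fun h : V => expR (time h * w)) g x.
    exact/diff_derivable/ed.
  apply: is_derive_eq.
  rewrite derive_expR_comp// derive_val /GRing.scale/=; ring.
have dF : derivable (fun h : V => pairmx (time y) (phi r (time h) *m space y)) g x.
  by apply/derivable_mxP => i j; exact: ex_derive.
by rewrite derive_mx//; apply/matrixP => i j; rewrite mxE derive_val.
Qed.

Lemma lie_bracketE (x y : V) :
  lie_bracket (Gp r) x y =
  pairmx 0 (time x *: (Amx r *m space y) - time y *: (Amx r *m space x)).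
Proof.
have vf1 z : left_invariant_vf (Gp r) z (gone (Gp r)) = z.
  by rewrite left_invariant_vfE /= time_pairmx phi0 mul1mx pairmx_eta.
rewrite /lie_bracket /vf_bracket 2!vf1.
rewrite (derive_left_invariant_vf x y) (derive_left_invariant_vf y x).
rewrite /= time_pairmx phi0 !mul1mx.
rewrite addrC -scaleN1r; apply: pair_ext.
  by rewrite timeD !time_pairmx mulr0 addr0.
by rewrite spaceD !space_pairmx scaleN1r addrC.
Qed.

End LieAlgebra.

(** * The abelian ideal, solvability and the spectrum of the adjoint maps *)

Section AlmostAbelian.
Variables (R : realType) (n : nat) (r : 'rV[R]_n).
Local Notation V := 'cV[R]_(1 + fdim n).

(** The ideal R^(4n+3), written as a kernel so that rank-nullity gives its dimension. *)
Definition ker_time : {vspace V} := lker (linfun (@usubmx R 1 (fdim n) 1)).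

Lemma mem_ker_time (x : V) : (x \in ker_time) = (time x == 0).
Proof.
rewrite memv_ker lfunE /=; apply/eqP/eqP => x0.
  by rewrite /time x0 mxE.
by rewrite [usubmx x]mx11_scalar -/(time x) x0 raddf0.
Qed.

Lemma dim_cV m : \dim {: 'cV[R]_m} = m.
Proof. by rewrite dimvf /dim /= muln1. Qed.

Lemma dim_ker_time : \dim ker_time = fdim n.
Proof.
have := limg_ker_dim (linfun (@usubmx R 1 (fdim n) 1)) fullv.
rewrite capfv dim_cV.
suff -> : (linfun (@usubmx R 1 (fdim n) 1) @: fullv)%VS = fullv.
  by rewrite dim_cV addnC; exact: addnI.
apply/vspaceP => w; rewrite memvf.
suff -> : w = linfun (@usubmx R 1 (fdim n) 1) (col_mx w 0).
  by rewrite memv_img ?memvf.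
by rewrite lfunE /= col_mxKu.
Qed.

Lemma lie_bracket_ker_time x y : lie_bracket (Gp r) x y \in ker_time.
Proof. by rewrite mem_ker_time lie_bracketE time_pairmx. Qed.

Lemma ker_time_abelian u v : u \in ker_time -> v \in ker_time ->
  lie_bracket (Gp r) u v = 0.
Proof.
rewrite !mem_ker_time lie_bracketE => /eqP-> /eqP->.
by rewrite !scale0r subrr /pairmx raddf0 col_mx0.
Qed.

Lemma Gp_almost_abelian : almost_abelian (Gp r).
Proof.
exists ker_time; split.
- by rewrite dim_ker_time dim_cV.
- by move=> *; exact: lie_bracket_ker_time.
- exact: ker_time_abelian.
Qed.

(** All brackets lie in the abelian ideal, so the second derived algebra vanishes. *)
Lemma Gp_lie_solvable : lie_solvable (Gp r).
Proof.
exists 2%N => /=; apply/eqP; rewrite -subv0; apply/span_subvP => z.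
case/allpairsP => -[u v] [/= /vbasis_mem hu /vbasis_mem hv ->].
suff sub : (derived (Gp r) fullv <= ker_time)%VS.
  by rewrite ker_time_abelian ?mem0v// (subvP sub).
apply/span_subvP => {}z /allpairsP[[a b] [_ _ ->]].
exact: lie_bracket_ker_time.
Qed.

(** Outside the diagonal, only the column of the time vector can be nonzero, and it is the first
    column; hence the matrix is lower triangular. *)
Lemma ad_mx_trig x : is_trig_mx (ad_mx (Gp r) x).
Proof.
apply/is_trig_mxP => i j; rewrite mxE lie_bracketE.
move: i (0 : 'I_1); apply: col_ind => [|i] ltij; first by rewrite pairmx_time.
rewrite pairmx_space.
have -> : time (delta_mx j 0 : V) = 0.
  have /negbTE j0 : lshift (fdim n) 0 != j by apply: contraTneq ltij => <-.
  by rewrite timeE mxE j0.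
have /negbTE ij : rshift 1 i != j by apply: contraTneq ltij => <-; rewrite ltnn.
have sj : space (delta_mx j 0 : V) i 0 = 0 by rewrite spaceE mxE ij.
by rewrite scale0r subr0 mxE Amx_mulE sj !mulr0.
Qed.

(** The eigenvalues of a triangular matrix are its diagonal entries, here images of real numbers. *)
Lemma Gp_completely_solvable : completely_solvable (Gp r).
Proof.
split=> [|x z]; first exact: Gp_lie_solvable.
rewrite eigenvalue_root_char char_poly_trig.
  rewrite rootE horner_prod => /prodf_eq0[i _].
  by rewrite hornerXsubC mxE subr_eq0 => /eqP->.
apply/is_trig_mxP => i j ltij; rewrite mxE.
by rewrite (is_trig_mxP (ad_mx_trig x))// rmorph0.
Qed.

End AlmostAbelian.

(** * Simple connectedness of normed spaces *)

Section SimplyConnected.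
Variables (R : realType) (V : normedModType R).

(** Segments join any two points, and a loop shrinks to its base point along segments. *)
Lemma normedMod_simply_connected : simply_connected R V.
Proof.
split=> [x y|f cf f01].
  exists (fun t => (1 - t) *: x + t *: y); split.
  - apply: continuous_subspaceT => t.
    apply: cvgD; apply: cvgZr_tmp; last exact: cvg_id.
    by apply: cvgB; [exact: cvg_cst|exact: cvg_id].
  - by rewrite subr0 scale1r scale0r addr0.
  - by rewrite subrr scale0r scale1r add0r.
exists (fun st => (1 - st.2) *: f st.1 + st.2 *: f 0); split.
(* Continuity of [f] is known only on [[0, 1]]: an open [W] of the line that witnesses it there is
   pulled back along [fst] to an open set of the plane. *)
- have cf1 : {within [set st : R * R | 0 <= st.1 <= 1 /\ 0 <= st.2 <= 1],
      continuous (fun st => f st.1)}.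
    apply/continuousP => O oO.
    have /continuousP/(_ O oO)/open_subspaceP[W oW WE] := cf.
    apply/open_subspaceP; exists (fst @^-1` W).
      by apply: open_comp => // st _; exact: cvg_fst.
    apply/seteqP; split=> -[s t] [/= Os [s01 t01]]; split=> //=.
    + have : (W `&` `[0, 1]) s by split=> //; rewrite /= in_itv.
      by rewrite WE => -[].
    + have : (f @^-1` O `&` `[0, 1]) s by split=> //; rewrite /= in_itv.
      by rewrite -WE => -[].
  have c1 : {within [set st : R * R | 0 <= st.1 <= 1 /\ 0 <= st.2 <= 1],
      continuous (fun st => 1 - st.2)}.
    apply: continuous_subspaceT => st.
    by apply: cvgB; [exact: cvg_cst|exact: cvg_snd].
  have c2 : {within [set st : R * R | 0 <= st.1 <= 1 /\ 0 <= st.2 <= 1],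
      continuous (fun st => st.2 *: f 0)}.
    by apply: continuous_subspaceT => st; apply: cvgZr_tmp; exact: cvg_snd.
  by move=> st; apply: cvgD; [apply: cvgZ; [exact: c1|exact: cf1]|exact: c2].
- by move=> s _; rewrite subr0 subrr !scale1r !scale0r addr0 add0r.
- by move=> t _; rewrite -f01 -scalerDl subrK scale1r.
Qed.

End SimplyConnected.

(** * Integrability of constant almost complex structures *)

Section ConstantComplexStructure.
Variables (R : realType) (N : nat).
Local Notation V := 'cV[R]_N.

Lemma derive_mulmx (A : 'M[R]_N) (X : V -> V) (g v : V) :
  derivable X g v -> 'D_v (fun h => A *m X h) g = A *m 'D_v X g.
Proof.
move=> dX; apply: cvg_lim; first exact: norm_hausdorff.
rewrite (_ : (fun h => _) = mulmx A \o
    (fun h : R => h^-1 *: ((X \o shift g) (h *: v) - X g))); last first.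
  by apply/funext => h /=; rewrite -scalemxAr mulmxBr.
by apply: continuous_cvg; [exact: continuous_mulmx|exact: dX].
Qed.

(** A constant [J] commutes with directional derivatives; once [J *m J] is replaced by -1, the eight
    terms of the Nijenhuis tensor cancel in pairs. *)
Lemma cst_complex_structure (J : 'M[R]_N) : J *m J = - 1%:M ->
  complex_structure (fun _ : V => J).
Proof.
move=> JJ; split=> //.
  by apply: smooth_mx => i j; exact: exp_poly_cst.
move=> X Y sX sY g.
have dX v : derivable X g v by apply: diff_derivable; have [] := sX 1%N.
have dY v : derivable Y g v by apply: diff_derivable; have [] := sY 1%N.
rewrite /vf_bracket /mul_vf !derive_mulmx// !(mulmxDr, mulmxN).
rewrite !mulmxA JJ !mulNmx !mul1mx.
rewrite !opprB !opprK.
set a := 'D_(X g) Y g; set b := 'D_(Y g) X g; set c := J *m 'D_(J *m X g) Y g.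
set d := J *m 'D_(J *m Y g) X g.
by apply/matrixP => i j; rewrite !mxE; ring.
Qed.

End ConstantComplexStructure.

(** * The quaternionic structure *)

Section SignedPermutation.
Variables (R : realType) (n : nat) (r : 'rV[R]_n).
Local Notation V := 'cV[R]_(1 + fdim n).

(* The basis vector [e_(k, c)] of H^(n+1), with H = R^4 indexed by
   1 = (false, false), i = (true, false), j = (false, true), k = (true, true),
   and [c = None] for the factor spanned by time and the kernel of [Amx]. *)
Definition qidx (kc : (bool * bool) * option 'I_n) : 'I_(1 + fdim n) :=
  match kc with
  | ((false, false), None) => lshift _ 0
  | ((true, false), None) => rshift 1 (lshift _ 0)
  | ((false, true), None) => rshift 1 (lshift _ (@Ordinal 3 1 isT))
  | ((true, true), None) => rshift 1 (lshift _ (@Ordinal 3 2 isT))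
  | ((false, false), Some i) => rshift 1 (rshift 3 (lshift _ i))
  | ((true, false), Some i) => rshift 1 (rshift 3 (rshift n (lshift _ i)))
  | ((false, true), Some i) =>
      rshift 1 (rshift 3 (rshift n (rshift n (lshift n i))))
  | ((true, true), Some i) =>
      rshift 1 (rshift 3 (rshift n (rshift n (rshift n i))))
  end.

Lemma qidx_inj : injective qidx.
Proof.
by move=> [[[] []] [i|]] [[[] []] [j|]] /(congr1 val) //=;
  try (have := ltn_ord i); try (have := ltn_ord j); move=> *;
  try lia; repeat congr (_, _); congr Some; apply/val_inj => /=; lia.
Qed.

Lemma qidx_bij : bijective qidx.
Proof.
apply: inj_card_bij qidx_inj _.
by rewrite !card_prod card_bool card_option !card_ord /fdim; lia.
Qed.

Definition weights1 : 'rV[R]_(1 + fdim n) := row_mx 0 (weights r).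

(** This is where the block [0_3] enters: its three zero weights and the zero weight given to time
    make up the fourfold weight of [c = None]. *)
Lemma weights1_qidx k l c : weights1 0 (qidx (k, c)) = weights1 0 (qidx (l, c)).
Proof.
move: k l c => [[] []] [[] []] [i|] //=;
  by rewrite /weights1 ?row_mxEr ?row_mxEl /weights ?row_mxEr ?row_mxEl ?mxE.
Qed.

Arguments qidx : simpl never.

(** The inverse of [qidx]; the default is never reached because [qidx] is surjective. *)
Definition unqidx (i : 'I_(1 + fdim n)) : (bool * bool) * option 'I_n :=
  odflt (false, false, None) [pick kc | qidx kc == i].

Lemma qidxK : cancel qidx unqidx.
Proof.
move=> kc; rewrite /unqidx; case: pickP => [kc' /eqP/qidx_inj //|/(_ kc)].
by rewrite eqxx.
Qed.

Lemma unqidxK : cancel unqidx qidx.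
Proof. by apply/(bij_can_sym qidx_bij); exact: qidxK. Qed.

(* The linear map [e_(k, c) |-> s k * e_(t k, c)]. *)
Definition spmx (t : bool * bool -> bool * bool) (s : bool * bool -> R)
    : 'M[R]_(1 + fdim n) :=
  \matrix_(i, j) (s (unqidx j).1 * (i == qidx (t (unqidx j).1, (unqidx j).2))%:R).

Lemma spmxM t s t' s' :
  spmx t s *m spmx t' s' = spmx (t \o t') (fun k => s' k * s (t' k)).
Proof.
apply/matrixP => i j; rewrite !mxE (bigD1 (qidx (t' (unqidx j).1, (unqidx j).2)))//=.
rewrite big1 ?addr0 => [|h /negbTE hj].
  by rewrite !mxE eqxx qidxK mulr1 mulrC mulrA.
by rewrite !mxE hj !mulr0.
Qed.

Lemma spmxN1 : spmx id (fun=> -1) = - 1%:M.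
Proof.
by apply/matrixP => i j; rewrite !mxE -surjective_pairing unqidxK mulN1r.
Qed.

Lemma spmx_opp t s : - spmx t s = spmx t (fun k => - s k).
Proof. by apply/matrixP => i j; rewrite !mxE mulNr. Qed.

(** [spmx] mixes only coordinates with the same [c], and on those the diagonal matrix is a
    scalar. *)
Lemma spmx_diag t s (d : 'rV[R]_(1 + fdim n)) :
  (forall k l c, d 0 (qidx (k, c)) = d 0 (qidx (l, c))) ->
  spmx t s *m diag_mx d = diag_mx d *m spmx t s.
Proof.
move=> dE; apply/matrixP => i j; rewrite mul_diag_mx mul_mx_diag !mxE.
have dj : d 0 j = d 0 (qidx (t (unqidx j).1, (unqidx j).2)).
  by rewrite -[in LHS](unqidxK j) [in LHS](surjective_pairing (unqidx j)).
case: eqP => [->|_]; last by rewrite !mulr0 mul0r.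
by rewrite dj mulrC.
Qed.

Lemma dL_diag (g h v : V) : dL (Gp r) g h v =
  diag_mx (map_mx (fun a => expR (time g * a)) weights1) *m v.
Proof.
rewrite dLE mul_diag_mx; apply/matrixP; apply: col_ind => [|i].
  by rewrite pairmx_time [RHS]mxE [X in X * _]mxE row_mxEl mxE mulr0 expR0 mul1r timeE.
by rewrite pairmx_space phi_mulE [RHS]mxE [X in _ = X * _]mxE row_mxEr spaceE.
Qed.

Lemma spmx_left_invariant t s : left_invariant (Gp r) (fun=> spmx t s).
Proof.
move=> g h v; rewrite !dL_diag !mulmxA spmx_diag// => k l c.
by rewrite [LHS]mxE [RHS]mxE (weights1_qidx k l).
Qed.

Lemma Gp_hypercomplex : exists J1 J2 J3 : V -> 'M[R]_(1 + fdim n),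
  left_invariant_hypercomplex (Gp r) J1 J2 J3.
Proof.
(* If [t] is an involution, the square of [spmx t s] is diagonal with entries [s k * s (t k)]. *)
have cs t s : t \o t = id -> (forall k, s k * s (t k) = -1) ->
    complex_structure (fun _ : V => spmx t s) /\
    left_invariant (Gp r) (fun _ : V => spmx t s).
  move=> tt ss; split; last exact: spmx_left_invariant.
  apply: cst_complex_structure; rewrite spmxM tt -spmxN1; congr spmx.
  exact/funext.
pose sg (b : bool) : R := (-1) ^+ b.
(* Left multiplications by i, j and k: the index map and the sign are read off the products with 1,
   i, j, k, such as i k = -j, j i = -k, k j = -i. *)
exists (fun=> spmx (fun k => (~~ k.1, k.2)) (fun k => sg k.1)).
exists (fun=> spmx (fun k => (k.1, ~~ k.2)) (fun k => sg (k.1 (+) k.2))).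
exists (fun=> spmx (fun k => (~~ k.1, ~~ k.2)) (fun k => sg k.2)).
split; [apply: cs|apply: cs|apply: cs|move=> _; split].
- by apply/funext => -[[] []].
- by move=> [[] []]; rewrite /sg /=; ring.
- by apply/funext => -[[] []].
- by move=> [[] []]; rewrite /sg /=; ring.
- by apply/funext => -[[] []].
- by move=> [[] []]; rewrite /sg /=; ring.
- by rewrite spmxM; congr spmx; apply/funext => -[[] []]; rewrite /sg /=; ring.
- rewrite spmxM spmx_opp; congr spmx.
  by apply/funext => -[[] []]; rewrite /sg /=; ring.
Qed.

End SignedPermutation.

(** * Block diagonal matrices and casts of square matrices *)

Section DirectSum.
Variable n : nat.

(* [dsum4] over an arbitrary ring. *)
Definition dsum (T : pzRingType) (B : 'M[T]_3) (X : 'M[T]_n) : 'M[T]_(fdim n) :=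
  block_mx B 0 0 (block_mx X 0 0 (block_mx X 0 0 (block_mx X 0 0 X))).

Lemma dsumM (T : pzRingType) (B C : 'M[T]_3) (X Y : 'M[T]_n) :
  dsum B X *m dsum C Y = dsum (B *m C) (X *m Y).
Proof.
by rewrite /dsum !mulmx_block !(mul0mx, mulmx0, addr0, add0r).
Qed.

Lemma dsum1 (T : pzRingType) : dsum 1%:M 1%:M = 1%:M :> 'M[T]_(fdim n).
Proof. by rewrite /dsum -!scalar_mx_block. Qed.

Lemma map_dsum (S T : pzRingType) (f : {rmorphism S -> T}) B X :
  map_mx f (dsum B X) = dsum (map_mx f B) (map_mx f X).
Proof. by rewrite /dsum !map_block_mx !map_mx0. Qed.

End DirectSum.

Lemma conform_mxE (T : Type) m n (e : m = n) (A : 'M[T]_n) (B : 'M[T]_m) i j :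
  conform_mx A B i j = B (cast_ord (esym e) i) (cast_ord (esym e) j).
Proof. by case: n / e A i j => A i j; rewrite conform_mx_id !cast_ord_id. Qed.

Lemma det_conform_mx (T : comPzRingType) m n (A : 'M[T]_n) (B : 'M[T]_m) :
  m = n -> \det (conform_mx A B) = \det B.
Proof. by move=> e; case: n / e A => A; rewrite conform_mx_id. Qed.

(** * The companion matrix: integrality, determinant and diagonalization *)

Section Delta.
Variables (R : realType) (n : nat) (p : {poly int}) (hp : Delta R n p).
Variables (r : 'rV[R]_n) (hr : ordered_roots p r).

Lemma size_real_poly (q : {poly int}) : size (real_poly R q) = size q.
Proof. by apply: size_map_inj_poly => //; exact: intr_inj. Qed.

(** A root outside the list [s] of n positive roots would give [p] n + 1 different roots. *)
Lemma ordered_roots_gt0 i : 0 < r 0 i.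
Proof.
have [pm sp _ [s [ss us rs s0]]] := hp.
apply: (allP s0); apply: contraT => ris.
have := @max_poly_roots _ (real_poly R p) (r 0 i :: s).
rewrite /= ris us rs (hr.1 i) /= size_real_poly sp ss ltnn.
rewrite -size_poly_eq0 size_real_poly sp.
by move=> /(_ isT isT isT).
Qed.

Lemma phi1E : phi r 1 = dsum 1%:M (diag_mx r).
Proof.
rewrite phiE -[RHS]/(dsum4 _ _) -diag_const_mx dsum4_diag; congr diag_mx.
rewrite /weights !map_row_mx -!map_mx_comp.
have -> : map_mx (fun a => expR (1 * a)) 0 = const_mx 1 :> 'rV[R]_3.
  by apply/rowP => i; rewrite !mxE mulr0 expR0.
have -> // : map_mx ((fun a => expR (1 * a)) \o @ln R) r = r.
by apply/rowP => i; rewrite !mxE /= mul1r lnK// posrE ordered_roots_gt0.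
Qed.

Definition Cint : 'M[int]_n := conform_mx 0 (companionmx p).

Lemma size_predp : (size p).-1 = n.
Proof. by have [_ -> _ _] := hp. Qed.

Lemma CmxE i j : Cmx R n p i j =
  if i == n.-1 :> nat then - (p`_j)%:~R else (i.+1 == j :> nat)%:R.
Proof.
have e : (size (real_poly R p)).-1 = n by rewrite size_real_poly size_predp.
by rewrite /Cmx (conform_mxE e) mxE /= e coef_map.
Qed.

Lemma map_Cint : map_mx intr Cint = Cmx R n p.
Proof.
apply/matrixP => i j; rewrite CmxE mxE (conform_mxE size_predp) mxE /= size_predp.
by case: ifP => _; rewrite ?rmorphN// rmorph_nat.
Qed.

(** The constant term of the characteristic polynomial [p] is (-1)^n times the determinant, and it
    equals (-1)^n on [Delta]. *)
Lemma det_Cint : \det Cint = 1.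
Proof.
have [pm sp p0 _] := hp.
rewrite det_conform_mx ?size_predp//.
have := char_poly_det (companionmx p).
rewrite companionmxK// -horner_coef0 p0 -{1}size_predp -{1}[(-1) ^+ _]mulr1.
by move/(mulfI _) => <- //; rewrite signr_eq0.
Qed.

Lemma Ctilde_int : exists M M' : 'M[int]_(fdim n),
  Ctilde R n p = map_mx intr M /\ M *m M' = 1%:M.
Proof.
exists (dsum 1%:M Cint), (dsum 1%:M (invmx Cint)); split.
  by rewrite map_dsum map_mx1 map_Cint.
by rewrite dsumM mul1mx mulmxV ?dsum1// unitmxE det_Cint unitr1.
Qed.

(** The column of powers of a root is an eigenvector for that root: the upper rows of the companion
    matrix raise the exponent by one, and the last row does so because [p] vanishes at the root. *)
Lemma Cmx_Vandermonde :
  Cmx R n p *m Vandermonde n r = Vandermonde n r *m diag_mx r.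
Proof.
apply/matrixP => i j; rewrite mul_mx_diag !mxE -exprSr.
under eq_bigr do rewrite CmxE mxE.
case: eqP => [iE|/eqP iN].
  have [pm sp _ _] := hp.
  have := hr.1 j; rewrite rootE horner_coef size_real_poly sp big_ord_recr /=.
  have -> : (real_poly R p)`_n = 1.
    have /monicP := monic_map (intr : {rmorphism int -> R}) pm.
    by rewrite lead_coefE size_real_poly sp.
  rewrite mul1r addrC addr_eq0 => /eqP rn.
  (* [prednK] requires [0 < n], which holds because [i] inhabits ['I_n]. *)
  rewrite iE prednK ?rn -?sumrN; last by case: (n) i {iE} => // -[].
  by apply: eq_bigr => k _; rewrite coef_map mulNr.
have iS : (i.+1 < n)%N by have := ltn_ord i; lia.
rewrite (bigD1 (Ordinal iS))//= eqxx mul1r big1 ?addr0// => k.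
by rewrite -val_eqE /= eq_sym => /negbTE->; rewrite mul0r.
Qed.

Lemma unit_Vandermonde : Vandermonde n r \in unitmx.
Proof.
rewrite unitmxE det_Vandermonde unitfE; apply/prodf_neq0 => i _.
by apply/prodf_neq0 => j ij; rewrite subr_eq0 gt_eqF// (hr.2 _ _ ij).
Qed.

(** The inverse Vandermonde matrix is used because its own inverse, the Vandermonde matrix, must
    stand on the left of the diagonal matrix. *)
Lemma exists_conjugates : exists Q, conjugates p r Q.
Proof.
exists (dsum 1%:M (invmx (Vandermonde n r))).
have VQ : dsum 1%:M (Vandermonde n r) *m dsum 1%:M (invmx (Vandermonde n r)) = 1%:M.
  by rewrite dsumM mul1mx mulmxV ?dsum1// unit_Vandermonde.
have [_ uQ] := mulmx1_unit VQ; split=> //.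
have -> : invmx (dsum 1%:M (invmx (Vandermonde n r))) = dsum 1%:M (Vandermonde n r).
  by rewrite -[LHS]mul1mx -VQ mulmxK.
rewrite phi1E !dsumM !mul1mx -Cmx_Vandermonde mulmxK//; exact: unit_Vandermonde.
Qed.

End Delta.

Lemma int_dist_lt1 (R : numDomainType) (k l : int) :
  `|k%:~R - l%:~R : R| < 1 -> k = l.
Proof.
rewrite -rmorphB -intr_norm -[1]/(1%:~R) ltr_int => ?; lia.
Qed.

(** * [Gamma_p] is a discrete cocompact subgroup *)

Section Lattice.
Variables (R : realType) (n : nat) (p : {poly int}) (hp : Delta R n p).
Variable r : 'rV[R]_n.
Variables (Q : 'M[R]_(fdim n)) (hQ : conjugates p r Q).
Local Notation V := 'cV[R]_(1 + fdim n).

(** The integral matrix [M] of [phi r 1] in the basis [Q] has an integral inverse, so integral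
    powers in both directions are available. *)
Lemma phi_int (k : int) : exists M : 'M[int]_(fdim n),
  phi r k%:~R *m Q = Q *m map_mx intr M.
Proof.
have [uQ QC] := hQ.
have [M [M' [CM MM']]] := Ctilde_int hp.
have phi1 : phi r 1 *m Q = Q *m map_mx intr M.
  by rewrite -CM -QC !mulmxA mulmxV// mul1mx.
have phiN1 : phi r (-1) *m Q = Q *m map_mx intr M'.
  rewrite -[Q in LHS]mulmx1 -(map_mx1 intr) -MM' map_mxM !mulmxA.
  by rewrite -[_ *m Q *m _]mulmxA -phi1 mulmxA phiK mul1mx.
have pos s P m : phi r s *m Q = Q *m map_mx intr P ->
    exists P' : 'M[int]_(fdim n), phi r (s *+ m) *m Q = Q *m map_mx intr P'.
  move=> sP; elim: m => [|m [P' IH]].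
    by exists 1%:M; rewrite phi0 map_mx1 mul1mx mulmx1.
  by exists (P *m P'); rewrite mulrS phiD -mulmxA IH mulmxA sP map_mxM mulmxA.
case: k => m; first exact: (pos 1 M).
have [P'] := pos _ _ m.+1 phiN1.
(* [Negz m] stands for -(m + 1), hence the power [m.+1] above. *)
have -> : (-1) *+ m.+1 = (Negz m)%:~R :> R by rewrite NegzE mulrNz mulNrn.
by exists P'.
Qed.

Lemma Gamma_subgroup : is_subgroup (Gp r) (Gamma_p Q).
Proof.
split=> [|x y [k [z ->]] [l [w ->]]|x [k [z ->]]] /=.
- by exists 0, 0; rewrite map_mx0 mulmx0.
- have [M kM] := phi_int k; exists (k + l), (z + M *m w).
  rewrite !time_pairmx !space_pairmx rmorphD map_mxD mulmxDr map_mxM !mulmxA.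
  by rewrite kM.
- have [M kM] := phi_int (- k); exists (- k), (- (M *m z)).
  rewrite !time_pairmx !space_pairmx -rmorphN mulmxA kM.
  by rewrite map_mxN map_mxM mulmxN mulmxA.
Qed.

(* [lattice_mx Q] maps the integral vectors onto [Gamma_p Q]. *)
Definition lattice_mx (A : 'M[R]_(fdim n)) : 'M[R]_(1 + fdim n) :=
  block_mx 1%:M 0 0 A.

Lemma lattice_mxE A t (v : 'cV[R]_(fdim n)) :
  lattice_mx A *m pairmx t v = pairmx t (A *m v).
Proof. by rewrite mul_block_col !mul0mx mul1mx addr0 add0r. Qed.

(** In the coordinates (t, Q^-1 v) the group consists of integral points, and a ball of radius 1 for
    the maximum norm around one contains no other. *)
Lemma Gamma_discrete : discrete_in (Gamma_p Q).
Proof.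
have [uQ _] := hQ => x xG; split; first by rewrite inE.
have [k [z xE]] := xG.
pose F (y : V) := lattice_mx (invmx Q) *m y.
exists (F @^-1` ball (F x) 1).
  by apply: continuous_mulmx; exact: nbhsx_ballx.
apply/seteqP; split=> [y [/= [_ Fxy] [l [w yE]]]|_ ->]; last first.
  by split=> //; exact: ballxx.
move: Fxy; rewrite /F yE xE !lattice_mxE !mulmxA mulVmx// !mul1mx => Fxy.
congr pairmx.
  have := Fxy (lshift _ 0) 0; rewrite !pairmx_time.
  by move=> /int_dist_lt1 ->.
congr (Q *m _); apply/matrixP => i j; rewrite (ord1 j) !mxE.
have := Fxy (rshift 1 i) 0; rewrite !pairmx_space !mxE.
by move=> /int_dist_lt1 ->.
Qed.

(** Row vectors are used to match [rV_compact]; this is why transposes appear below. *)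
Definition unit_cube : set 'rV[R]_(1 + fdim n) :=
  [set u | forall i, `[0, 1]%classic (u ord0 i)].

Lemma unit_cube_compact : compact unit_cube.
Proof.
apply: (@rV_compact (R : realType) (1 + fdim n) (fun=> `[0, 1]%classic)) => i.
exact: segment_compact.
Qed.

(** Time is reduced first. Translating by [k] also applies [phi r k%:~R] to the space part, so the
    space coordinates are rounded only afterwards. *)
Lemma unit_cube_cover (g : V) : exists2 u, unit_cube u &
  exists2 x, Gamma_p Q x & gmul (Gp r) x g = lattice_mx Q *m u^T.
Proof.
have [uQ _] := hQ.
have fl (t : R) : `[0, 1]%classic ((- Num.floor t)%:~R + t).
  have /andP[t0 t1] := floor_itv t.
  by rewrite /= in_itv /=; move: t0 t1; rewrite rmorphN rmorphD /=; lra.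
set k := - Num.floor (time g).
set v := invmx Q *m (phi r k%:~R *m space g).
pose z : 'cV[int]_(fdim n) := \col_i - Num.floor (v i 0).
pose u : V := pairmx (k%:~R + time g) (map_mx intr z + v).
exists u^T.
  suff u01 : forall i j, `[0, 1]%classic (u i j) by move=> i; rewrite mxE.
  refine (@col_ind n (fun i j => `[0, 1]%classic (u i j)) _ _) => [|i].
    by rewrite pairmx_time; exact: fl.
  rewrite pairmx_space [X in _ X]mxE [X in _ (X + _)]mxE.
  by rewrite [X in _ (X%:~R + _)]mxE; exact: fl.
exists (pairmx k%:~R (Q *m map_mx intr z)); first by exists k, z.
rewrite trmxK lattice_mxE /= time_pairmx space_pairmx mulmxDr.
by rewrite [Q *m v]mulmxA mulmxV// mul1mx.
Qed.

(** For y in the group, y g = (y x^-1)(x g). *)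
Lemma same_coset_mul x g : Gamma_p Q x ->
  same_coset (Gp r) (Gamma_p Q) (gmul (Gp r) x g) g.
Proof.
have [_ GM GV] := Gamma_subgroup; have [mulA mul1 mulV] := Gp_is_group r.
move=> Gx; apply/asboolP/seteqP; split=> _ [y Gy <-].
  by exists (gmul (Gp r) y x); [exact: GM|rewrite -mulA].
exists (gmul (Gp r) y (ginv (Gp r) x)); first by apply: GM => //; exact: GV.
by rewrite -mulA [X in gmul _ y X]mulA (mulV x).1 (mul1 g).1.
Qed.

(** The quotient is the continuous image of the compact unit cube. *)
Lemma Gamma_cocompact : compact [set: quotient_space (Gp r) (Gamma_p Q)].
Proof.
pose T := quotient_space (Gp r) (Gamma_p Q).
pose pi : V -> T := \pi_T%qT.
have -> : [set: T] = (fun u => pi (lattice_mx Q *m u^T)) @` unit_cube.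
  apply/seteqP; split=> // q _.
  have [u cu [x Gx xE]] := unit_cube_cover (repr q).
  exists u => //; rewrite -xE -[RHS]reprK; apply/eqmodP.
  exact: same_coset_mul.
apply: continuous_compact unit_cube_compact.
apply: continuous_subspaceT => u.
apply: (@continuous_comp _ _ _ (fun u => lattice_mx Q *m u^T) pi).
  apply: (@continuous_comp _ _ _ trmx (mulmx (lattice_mx Q))).
    exact: continuous_trmx.
  exact: continuous_mulmx.
exact: pi_continuous.
Qed.

Lemma Gamma_lattice : lattice (Gp r) (Gamma_p Q).
Proof.
split; [exact: Gamma_subgroup|exact: Gamma_discrete|exact: Gamma_cocompact].
Qed.

End Lattice.

Unset Implicit Arguments.

Theorem proposition7p2 (R : realType) (n : nat) (hn : (2 <= n)%N)
    (p : {poly int}) (hp : Delta R n p)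
    (r : 'rV[R]_n) (hr : ordered_roots p r) :
  [/\ \dim {: 'cV[R]_(1 + fdim n)} = (4 * n + 4)%N,
      is_lie_group (Gp r),
      simply_connected R 'cV[R]_(1 + fdim n),
      almost_abelian (Gp r)
    & completely_solvable (Gp r)] /\
  [/\ (exists J1 J2 J3 : 'cV[R]_(1 + fdim n) -> 'M[R]_(1 + fdim n),
         left_invariant_hypercomplex (Gp r) J1 J2 J3),
      (exists Q : 'M[R]_(fdim n), conjugates p r Q)
    & forall Q : 'M[R]_(fdim n), conjugates p r Q ->
        lattice (Gp r) (Gamma_p Q)].
Proof.
split; split.
- by rewrite dim_cV /fdim; lia.
- exact: Gp_is_lie_group.
- exact: normedMod_simply_connected.
- exact: Gp_almost_abelian.
- exact: Gp_completely_solvable.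
- exact: Gp_hypercomplex.
- exact: exists_conjugates.
- by move=> Q hQ; exact: (Gamma_lattice hp hQ).
Qed.
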